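(* Let $f:\mathbb{R}^n\to\mathbb{R}$ be convex and $L$-smooth with a minimizer $x^\star$, and let $\mathcal{P}\subseteq\mathbb{R}^{n\times n}$ be a closed convex set with $0\in\mathcal{P}$, $L^{-1}I\in\mathcal{P}$ and $\operatorname{diam}(\mathcal{P})\le D<\infty$. Let $K\ge1$ and $\theta\in[\tfrac12,LD)$. Suppose AGD (see context) starts from $(x',z')$ and runs for $K$ iterations to output $\hat x$. Then HDM-AGD (see context), started from $(x^1,z^1)=(\hat x,z')$ with parameter $\theta$ and stepsize $\eta=\frac{D}{(LD+1)\sqrt K}$, satisfies $$f(x^{K+1})-f(x^\star)\le\Big[\frac{1}{2\theta}+\Big(8-\frac4\theta\Big)\Big(\frac{LD-\omega_K^\star}{LD-\theta}\Big)\Big]\frac{2L\|z'-x^\star\|^2}{K^2}+\mathcal{O}\Big(\frac{\rho_K}{K^3}\Big),$$ where $\omega_K^\star=-\min_{P\in\mathcal{P}}\frac LK\sum_{k=1}^Kh_{y^k}(P)$, $\rho_K=D(LD+1)\sqrt K$, and the constant hidden in $\mathcal{O}(\cdot)$ is independent of $K$ (it may depend on $L,D,\theta,\|z'-x^\star\|$).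
   Context: $\|\cdot\|$ is the Euclidean norm, $\operatorname{diam}$ is taken in the Frobenius norm, $\Pi_{\mathcal{P}}$ is the orthogonal projection onto $\mathcal{P}$. $L$-smooth means $\nabla f$ is $L$-Lipschitz. For non-stationary $y$, $$h_y(P):=\frac{f(y-P\nabla f(y))-f(y)}{\|\nabla f(y)\|^2},\qquad \nabla h_y(P)=-\frac{\nabla f(y-P\nabla f(y))\nabla f(y)^\top}{\|\nabla f(y)\|^2}.$$ The sequence $(A_k)_{k\ge0}$ is the increasing sequence with $A_0=0$ and $A_{k+1}=(A_{k+1}-A_k)^2$, i.e. $A_{k+1}=A_k+\frac12(1+\sqrt{4A_k+1})$ (so $A_1=1$). AGD: starting from $(x^0,z^0)=(x',z')$, for $k=0,1,\dots,K-1$: $$y^k=x^k+\Big(1-\frac{A_k}{A_{k+1}}\Big)(z^k-x^k),\quad x^{k+1}=y^k-\frac1L\nabla f(y^k),\quad z^{k+1}=z^k-\frac{A_{k+1}-A_k}{L}\nabla f(y^k);$$ the output is $\hat x=x^K$. HDM-AGD: given $(x^1,z^1)$, $P_1\in\mathcal{P}$, $\eta>0$, $\theta$, for $k=1,2,\dots,K$: $$y^k=x^k+\Big(1-\frac{A_k}{A_{k+1}}\Big)(z^k-x^k),$$ $$x^{k+1}\in\operatorname{argmin}_{x\in\{y^k-\frac1L\nabla f(y^k),\ y^k-P_k\nabla f(y^k),\ x^k\}}f(x),$$ $$P_{k+1}=\Pi_{\mathcal{P}}[P_k-\eta\nabla h_{y^k}(P_k)],$$ $$v_k=\max\Big\{\frac{1}{2\max\{-h_{y^k}(P_k),1/(2L)\}},\frac{L}{2\theta}\Big\},\qquad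 z^{k+1}=z^k-\frac{A_{k+1}-A_k}{v_k}\nabla f(y^k).$$ The points $y^1,\dots,y^K$ are assumed non-stationary, so that the feedbacks are defined. *)

(* Defs.v *)
From HB Require Import structures.
From mathcomp Require Import all_boot all_order all_algebra.
From mathcomp Require Import all_classical all_reals all_analysis.

Set Implicit Arguments.
Unset Strict Implicit.
Unset Printing Implicit Defensive.

Import Order.TTheory GRing.Theory Num.Theory.
Import numFieldNormedType.Exports.
Local Open Scope classical_set_scope.
Local Open Scope ring_scope.

(* [`|X|] on matrices is the sup norm, so the Frobenius norm (the Euclidean
   norm on column vectors) is defined here; both induce the same topology. *)
Definition fnorm (R : realType) (m n : nat) (X : 'M[R]_(m, n)) : R :=
  Num.sqrt (\sum_(i < m) \sum_(j < n) X i j ^+ 2).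

Definition diam (R : realType) (m n : nat) (S : set 'M[R]_(m, n)) : \bar R :=
  ereal_sup [set (fnorm (X - Y))%:E | X in S & Y in S].

(* Gradient of a differentiable function, for the Frobenius inner product. *)
Definition grad (R : realType) (m n : nat) (F : 'M[R]_(m, n) -> R)
    (X : 'M[R]_(m, n)) : 'M[R]_(m, n) :=
  \matrix_(i < m, j < n) ('D_(delta_mx i j) (F : _ -> R^o) X : R).

Definition smooth (R : realType) (n : nat) (L : R) (f : 'cV[R]_n -> R) : Prop :=
  (forall x : 'cV[R]_n, differentiable (f : _ -> R^o) x) /\
  (forall x y : 'cV[R]_n,
     fnorm (grad f x - grad f y) <= L * fnorm (x - y)).

Definition argmin (R : realType) (T : Type) (S : set T) (F : T -> R) : set T :=
  [set x | S x /\ forall y, S y -> F x <= F y].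

Definition proj (R : realType) (m n : nat) (S : set 'M[R]_(m, n))
    (X : 'M[R]_(m, n)) : set 'M[R]_(m, n) :=
  argmin S (fun Q => fnorm (X - Q)).

(* The positive root a = A (k+1) - A k of a ^ 2 = A k + a. *)
Fixpoint A (R : realType) (k : nat) : R :=
  if k is k'.+1 then A R k' + (1 + Num.sqrt (4 * A R k' + 1)) / 2 else 0.

Definition extrapolate (R : realType) (n k : nat) (x z : 'cV[R]_n) : 'cV[R]_n :=
  x + (1 - A R k / A R k.+1) *: (z - x).

Fixpoint agd (R : realType) (n : nat) (f : 'cV[R]_n -> R) (L : R)
    (x0 z0 : 'cV[R]_n) (k : nat) : 'cV[R]_n * 'cV[R]_n :=
  if k is k'.+1 then
    let: (x, z) := agd f L x0 z0 k' in
    let y := extrapolate k' x z in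
    (y - L^-1 *: grad f y,
     z - ((A R k'.+1 - A R k') / L) *: grad f y)
  else (x0, z0).

Definition feedback (R : realType) (n : nat) (f : 'cV[R]_n -> R)
    (y : 'cV[R]_n) (P : 'M[R]_n) : R :=
  (f (y - P *m grad f y) - f y) / fnorm (grad f y) ^+ 2.

Definition hdm_weight (R : realType) (n : nat) (f : 'cV[R]_n -> R) (L theta : R)
    (y : 'cV[R]_n) (P : 'M[R]_n) : R :=
  Num.max (1 / (2 * Num.max (- feedback f y P) (1 / (2 * L))))
          (L / (2 * theta)).

(* The iterations k = 1, ..., K; a relation, since ties in the choice of
   x (k+1) may be broken in any way. *)
Definition hdm_agd (R : realType) (n : nat) (f : 'cV[R]_n -> R) (L theta eta : R)
    (PP : set 'M[R]_n) (K : nat) (x y z : nat -> 'cV[R]_n) (P : nat -> 'M[R]_n)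
    : Prop :=
  PP (P 1%N) /\
  forall k : nat, (1 <= k <= K)%N ->
    [/\ y k = extrapolate k (x k) (z k),
        argmin [set y k - L^-1 *: grad f (y k);
                    y k - P k *m grad f (y k);
                    x k] f (x k.+1),
        proj PP (P k - eta *: grad (feedback f (y k)) (P k)) (P k.+1) &
        z k.+1 = z k - ((A R k.+1 - A R k) / hdm_weight f L theta (y k) (P k))
                         *: grad f (y k)].

(* Main.v *)
Require Import Defs.
From HB Require Import structures.
From mathcomp Require Import all_boot all_order all_algebra.
From mathcomp Require Import all_classical all_reals all_analysis.
From mathcomp Require Import ring lra.

Set Implicit Arguments.
Unset Strict Implicit.
Unset Printing Implicit Defensive.

Import Order.TTheory GRing.Theory Num.Theory.
Import numFieldNormedType.Exports.
Local Open Scope classical_set_scope.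
Local Open Scope ring_scope.

(** Write d_k = |z^k - x*|, delta_k = f(x^k) - f(x* ), a_k = A_(k+1) - A_k,
    Phi_k = A_k delta_k, r = |z' - x*|, v_k for the weight of HDM-AGD and h_k
    for the feedback at y^k.

    Since a_k^2 = A_(k+1), the usual estimate-sequence computation
    ([accelerated_step]) gives
      Phi_(k+1) - Phi_k <= (v_k / 2) (d_k^2 - d_(k+1)^2)
    as soon as x^(k+1) decreases f by |grad f(y^k)|^2 / (2 v_k).  The weights
    vary with k and the d_k are not controlled, so this cannot be summed as it
    stands.  The remedy is to divide by v_k: the distances then telescope, and
    with c = 2 theta / L, the largest possible value of 1 / v_k,
      c (Phi_(k+1) - Phi_k)
        <= (d_k^2 - d_(k+1)^2) / 2 + (c - 1 / v_k) (Phi_(k+1) - Phi_k).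
    Two facts bound the last term.

    - The warm start: AGD gives delta_1 <= 2 L r^2 / K^2 ([agd_rate]), f
      decreases along x^1, x^2, ..., and a_k <= k + 1 <= 2 K, so each increment
      Phi_(k+1) - Phi_k is at most M = 4 L r^2 / K.

    - Online learning: c - 1 / v_k vanishes unless -h_k(P_k) < theta / L, and
      as -h_k(P_k) <= D it is bounded by an affine function of h_k(P_k)
      ([hdm_weight_deficit]).  The sum of the h_k(P_k) is compared to that of
      the best fixed P by the regret bound of projected gradient descent on
      the convex functions h_k, whose gradients are bounded by L D + 1
      ([hdm_regret]).

    Summing ([hdm_potential]) and dividing by A_(K+1) >= K^2 / 4 gives the
    stated bound; the regret and the term Phi_1 = delta_1 make up the
    remainder of order rho_K / K^3.  The minimum over the set of
    preconditioners is attained because that set is closed and bounded. *)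

(** * The Frobenius inner product *)

Definition dot (R : realType) (m n : nat) (X Y : 'M[R]_(m, n)) : R :=
  \sum_(i < m) \sum_(j < n) X i j * Y i j.

Section Dot.
Context {R : realType} {m n : nat}.
Implicit Types (X Y Z : 'M[R]_(m, n)) (c : R).

Lemma dotC X Y : dot X Y = dot Y X.
Proof.
by apply: eq_bigr => i _; apply: eq_bigr => j _; rewrite mulrC.
Qed.

Lemma dotDl X Y Z : dot (X + Y) Z = dot X Z + dot Y Z.
Proof.
rewrite /dot -big_split; apply: eq_bigr => i _; rewrite -big_split.
by apply: eq_bigr => j _; rewrite mxE mulrDl.
Qed.

Lemma dotZl c X Y : dot (c *: X) Y = c * dot X Y.
Proof.
rewrite /dot mulr_sumr; apply: eq_bigr => i _; rewrite mulr_sumr.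
by apply: eq_bigr => j _; rewrite mxE mulrA.
Qed.

Lemma dotNl X Y : dot (- X) Y = - dot X Y.
Proof. by rewrite -scaleN1r dotZl mulN1r. Qed.

Lemma dotDr X Y Z : dot Z (X + Y) = dot Z X + dot Z Y.
Proof. by rewrite dotC dotDl !(dotC Z). Qed.

Lemma dotZr c X Y : dot Y (c *: X) = c * dot Y X.
Proof. by rewrite dotC dotZl (dotC Y). Qed.

Lemma dotNr X Y : dot Y (- X) = - dot Y X.
Proof. by rewrite dotC dotNl (dotC Y). Qed.

Definition dotE := (dotDl, dotDr, dotNl, dotNr, dotZl, dotZr).

Lemma dot_ge0 X : 0 <= dot X X.
Proof.
by apply: sumr_ge0 => i _; apply: sumr_ge0 => j _; rewrite -expr2 sqr_ge0.
Qed.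

Lemma fnormE X : fnorm X = Num.sqrt (dot X X).
Proof.
by congr Num.sqrt; apply: eq_bigr => i _; apply: eq_bigr => j _; rewrite expr2.
Qed.

Lemma fnorm_sqr X : fnorm X ^+ 2 = dot X X.
Proof. by rewrite fnormE sqr_sqrtr ?dot_ge0. Qed.

Lemma fnorm_sqrBZ X Y c :
  fnorm (X - c *: Y) ^+ 2
  = fnorm X ^+ 2 - 2 * c * dot X Y + c ^+ 2 * fnorm Y ^+ 2.
Proof. by rewrite !fnorm_sqr !dotE (dotC Y X); ring. Qed.

Lemma fnorm_ge0 X : 0 <= fnorm X.
Proof. exact: sqrtr_ge0. Qed.

Lemma fnormZ c X : fnorm (c *: X) = `|c| * fnorm X.
Proof.
by rewrite !fnormE dotZl dotZr mulrA sqrtrM ?sqr_ge0 -?expr2 ?sqrtr_sqr ?sqr_ge0.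
Qed.

Lemma fnormN X : fnorm (- X) = fnorm X.
Proof. by rewrite -scaleN1r fnormZ normrN1 mul1r. Qed.

Lemma coord_le_fnorm X i j : `|X i j| <= fnorm X.
Proof.
rewrite -(ler_pXn2r (ltn0Sn 1)) ?nnegrE ?fnorm_ge0 //.
rewrite fnorm_sqr real_normK ?num_real // /dot (bigD1 i) //= (bigD1 j) //=.
rewrite -expr2 -addrA lerDl addr_ge0 //.
  by apply: sumr_ge0 => k _; rewrite -expr2 sqr_ge0.
by apply: sumr_ge0 => k _; apply: sumr_ge0 => l _; rewrite -expr2 sqr_ge0.
Qed.

Lemma fnorm_gt0 X : X != 0 -> 0 < fnorm X.
Proof.
move=> X0; rewrite lt_def fnorm_ge0 andbT; apply: contra X0 => /eqP nX0.
apply/eqP/matrixP => i j; apply/eqP.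
by rewrite mxE -normr_le0 -nX0 coord_le_fnorm.
Qed.

(** Expand the square of [fnorm Y *: X - fnorm X *: Y]. *)
Lemma cauchy_schwarz X Y : dot X Y <= fnorm X * fnorm Y.
Proof.
have [->|X0] := eqVneq X 0.
  by rewrite -(scale0r 0) dotZl mul0r mulr_ge0 ?fnorm_ge0.
have [->|Y0] := eqVneq Y 0.
  by rewrite -(scale0r 0) dotZr mul0r mulr_ge0 ?fnorm_ge0.
have := fnorm_gt0 X0; have := fnorm_gt0 Y0.
have := dot_ge0 (fnorm Y *: X - fnorm X *: Y).
rewrite !dotE -!fnorm_sqr (dotC Y X).
move: (fnorm X) (fnorm Y) (dot X Y) => a b d h b0 a0.
have ab0 : 0 < a * b by rewrite mulr_gt0.
by rewrite -(ler_pM2l ab0); lra.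
Qed.

Lemma fnormD X Y : fnorm (X + Y) <= fnorm X + fnorm Y.
Proof.
rewrite -(ler_pXn2r (ltn0Sn 1)) ?nnegrE ?addr_ge0 ?fnorm_ge0 //.
rewrite fnorm_sqr !dotE (dotC Y X) sqrrD !fnorm_sqr.
have := cauchy_schwarz X Y; lra.
Qed.

End Dot.

(** Cauchy-Schwarz on each entry, a product of a row and a column. *)
Lemma fnormM (R : realType) (m n p : nat) (X : 'M[R]_(m, n)) (Y : 'M[R]_(n, p)) :
  fnorm (X *m Y) <= fnorm X * fnorm Y.
Proof.
rewrite -(ler_pXn2r (ltn0Sn 1)) ?nnegrE ?mulr_ge0 ?fnorm_ge0 //.
rewrite exprMn !fnorm_sqr.
have entry i j :
    (X *m Y) i j * (X *m Y) i j
      <= dot (row i X) (row i X) * dot (col j Y) (col j Y).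
  have -> : (X *m Y) i j = dot (row i X) (col j Y)^T.
    by rewrite mxE /dot big_ord1; apply: eq_bigr => k _; rewrite !mxE.
  have -> : dot (col j Y) (col j Y) = dot (col j Y)^T (col j Y)^T.
    rewrite /dot exchange_big; apply: eq_bigr => k _.
    by apply: eq_bigr => l _; rewrite !mxE.
  set u := row i X; set w := (col j Y)^T.
  rewrite -!fnorm_sqr -exprMn -expr2 -ler_sqrt ?sqr_ge0 //.
  rewrite !sqrtr_sqr [leRHS]ger0_norm ?mulr_ge0 ?fnorm_ge0 //.
  rewrite ler_norml cauchy_schwarz andbT lerNl -dotNl.
  by rewrite -(fnormN u) cauchy_schwarz.
have -> : dot X X = \sum_i dot (row i X) (row i X).
  apply: eq_bigr => i _; rewrite /dot big_ord1.
  by apply: eq_bigr => k _; rewrite !mxE.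
have -> : dot Y Y = \sum_j dot (col j Y) (col j Y).
  rewrite /dot exchange_big; apply: eq_bigr => j _.
  by apply: eq_bigr => k _; rewrite big_ord1 !mxE.
rewrite mulr_suml; apply: ler_sum => i _; rewrite mulr_sumr.
by apply: ler_sum => j _.
Qed.

(** * Gradients of smooth convex functions *)

Lemma derive_dot_grad (R : realType) (m n : nat) (F : 'M[R]_(m, n) -> R)
    (X V : 'M[R]_(m, n)) :
  differentiable (F : _ -> R^o) X ->
  'D_V (F : _ -> R^o) X = dot (grad F X) V :> R.
Proof.
move=> dF; rewrite deriveE // {1}(matrix_sum_delta V) linear_sum.
apply: eq_bigr => i _; rewrite linear_sum; apply: eq_bigr => j _.
by rewrite linearZ mxE -deriveE // mulrC.
Qed.

Section SmoothConvex.
Context {R : realType} {n : nat}.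
Implicit Types (f : 'cV[R]_n -> R) (x y d : 'cV[R]_n).

Lemma derive_along_line f x d (t : R) :
  (forall u, differentiable (f : _ -> R^o) u) ->
  is_derive t (1 : R) (fun s : R => (f (x + s *: d) : R^o))
    (dot (grad f (x + t *: d)) d).
Proof.
move=> df; have dfd := diff_derivable (v := d) (df (x + t *: d)).
have E : (fun h : R => h^-1 *: (((fun s : R => (f (x + s *: d) : R^o)) \o shift t)
             (h *: (1 : R^o)) - f (x + t *: d)))
    = (fun h : R => h^-1 *: (((f : _ -> R^o) \o shift (x + t *: d)) (h *: d)
             - f (x + t *: d))).
  apply/funext => h /=; congr (_ *: (f _ - _)).
  by rewrite scalerDl [h *: 1]mulr1 addrCA addrA.
split; first by rewrite /derivable E.
by rewrite -derive_dot_grad // /derive E.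
Qed.

(** Convexity bounds the difference quotients of f along [y - x] by
    [f y - f x]; let the step tend to 0 from the right. *)
Lemma convex_gradient_le f x y :
  (forall u, differentiable (f : _ -> R^o) u) ->
  convex_function (setT : set (convex_lmodType 'cV[R]_n)) f ->
  f x + dot (grad f x) (y - x) <= f y.
Proof.
move=> df cf; rewrite -lerBrDl -derive_dot_grad //.
have /cvg_dnbhs_at_right H := diff_derivable (v := y - x) (df x).
apply: (cvgr_to_le H); near=> t.
have t0 : 0 < t by near: t; exact: nbhs_right_gt.
have t1 : t <= 1 by near: t; apply: nbhs_right_le.
rewrite /= [leLHS]mulrC ler_pdivrMr // lerBlDl.
have : f (t *: y + (1 - t) *: x) <= t * f y + (1 - t) * f x.
  exact: (cf (Itv01 (ltW t0) t1) y x (in_setT _) (in_setT _)).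
have -> : t *: y + (1 - t) *: x = t *: (y - x) + x.
  by rewrite scalerBr scalerBl scale1r -addrA [- _ + _]addrC.
lra.
Unshelve. all: by end_near. Qed.

(** The mean value theorem is applied to f along the segment minus the
    claimed bound, whose derivative is at most 0 because the gradient is
    Lipschitz; integrating the gradient is thereby avoided, while the
    constant [L / 2] is kept. *)
Lemma quadratic_upper_bound f (L : R) x d :
  smooth L f ->
  f (x + d) <= f x + dot (grad f x) d + L / 2 * fnorm d ^+ 2.
Proof.
move=> [df lipf].
pose phi : R -> R^o := (fun t => (f (x + t *: d) : R^o))
   - (dot (grad f x) d *: (id : R -> R^o))
   - ((L / 2 * fnorm d ^+ 2) *: ((id : R -> R) ^+ 2 : R -> R^o)).
pose dphi (t : R) : R := dot (grad f (x + t *: d)) d - dot (grad f x) d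
   - L * fnorm d ^+ 2 * t.
have dphiP (t : R) : is_derive t (1 : R) phi (dphi t).
  have H := derive_along_line x d t df.
  rewrite /phi; apply: is_derive_eq.
  rewrite /dphi /= /GRing.scale /= expr1; lra.
have phi_cont : {within `[0, 1], continuous phi}.
  by apply: derivable_within_continuous => t _; have [] := dphiP t.
have [c /andP[c0 c1]] := @MVT R phi dphi 0 1 ltr01 (fun t _ => dphiP t) phi_cont.
rewrite bnd_simp in c0; rewrite bnd_simp in c1.
rewrite /phi /dphi !fctE scale1r scale0r addr0 subr0 mulr1.
have := cauchy_schwarz (grad f (x + c *: d) - grad f x) d.
have := lipf (x + c *: d) x.
rewrite (_ : x + c *: d - x = c *: d); last by rewrite [x + _]addrC addrK.
rewrite fnormZ gtr0_norm // dotDl dotNl.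
move=> /(ler_wpM2r (fnorm_ge0 d)) lip cs.
move: (f _) (f _) (dot _ _) (dot _ _) (fnorm (_ - _)) lip cs => p q u v w lip cs.
rewrite /GRing.scale /= expr1n expr0n /=; lra.
Qed.

Lemma gradient_step_decrease f (L : R) x :
  0 < L -> smooth L f ->
  f (x - L^-1 *: grad f x) <= f x - fnorm (grad f x) ^+ 2 / (2 * L).
Proof.
move=> L0 sf; have := quadratic_upper_bound x (- (L^-1 *: grad f x)) sf.
rewrite fnormN fnormZ dotNr dotZr -fnorm_sqr exprMn gtr0_norm ?invr_gt0 //.
move: (f _) (f _) (fnorm _ ^+ 2) => p q w.
suff -> : L / 2 * (L^-1 ^+ 2 * w) = L^-1 * w / 2 by rewrite invfM; lra.
by field; rewrite gt_eqF.
Qed.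

End SmoothConvex.

(** * The feedback as a function of the preconditioner *)

Section Feedback.
Context {R : realType} {n : nat}.
Variables (f : 'cV[R]_n -> R) (y : 'cV[R]_n).
Hypothesis df : forall u, differentiable (f : _ -> R^o) u.
Implicit Types (P Q : 'M[R]_n).

Lemma dot_outer (u v : 'cV[R]_n) P : dot (u *m v^T) P = dot u (P *m v).
Proof.
apply: eq_bigr => i _; rewrite big_ord1 mxE mulr_sumr; apply: eq_bigr => j _.
by rewrite mxE big_ord1 !mxE -mulrA [v j _ * _]mulrC.
Qed.

Lemma fnorm_tr (u : 'cV[R]_n) : fnorm u^T = fnorm u.
Proof.
rewrite /fnorm exchange_big /=; congr Num.sqrt.
by apply: eq_bigr => i _; apply: eq_bigr => j _; rewrite mxE.
Qed.

(** Moving P along [delta_mx i j] moves the argument of f along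
    [- delta_mx i j *m grad f y], so this is a chain rule. *)
Lemma grad_feedback P :
  grad (feedback f y) P
  = - (fnorm (grad f y) ^- 2 *: (grad f (y - P *m grad f y) *m (grad f y)^T)).
Proof.
set g := grad f y; set w := y - P *m g.
apply/matrixP => i j; rewrite !mxE big_ord1.
have dfd := diff_derivable (v := - (delta_mx i j *m g)) (df w).
have Dfw : 'D_(- (delta_mx i j *m g)) (f : _ -> R^o) w
    = - ((grad f w) i ord0 * g j ord0) :> R.
  rewrite derive_dot_grad // dotNr -dot_outer /dot (bigD1 i) //= (bigD1 j) //=.
  rewrite [X in _ + X + _]big1 => [|k kj]; last first.
    by rewrite !mxE eqxx (negbTE kj) mulr0.
  rewrite [X in _ + X]big1 => [|k ki]; last first.
    by apply: big1 => l _; rewrite !mxE (negbTE ki) mulr0.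
  by rewrite !addr0 !mxE !eqxx mulr1 big_ord1 !mxE.
have quotE : (fun h : R => h^-1 *: (((feedback f y : _ -> R^o) \o shift P)
      (h *: delta_mx i j) - feedback f y P))
    = (fun h : R => fnorm g ^- 2 *:
      (h^-1 *: ((f : _ -> R^o) (h *: (- (delta_mx i j *m g)) + w) - f w))).
  apply/funext => h; rewrite /feedback /= -/g.
  have -> : y - (h *: delta_mx i j + P) *m g = h *: - (delta_mx i j *m g) + w.
    by rewrite mulmxDl -scalemxAl opprD addrCA scalerN.
  rewrite -/w scalerA [fnorm g ^- 2 * _]mulrC -scalerA; congr (_ *: _).
  by rewrite -mulrBl opprB addrA subrK mulrC.
rewrite /derive quotE; apply: cvg_lim => //.
rewrite [(grad f y)^T _ _]mxE -mulrN -Dfw.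
exact: (cvgZ (cvg_cst _) dfd).
Qed.

Lemma dot_grad_feedback P Q :
  dot (grad (feedback f y) P) Q
  = - (dot (grad f (y - P *m grad f y)) (Q *m grad f y) / fnorm (grad f y) ^+ 2).
Proof. by rewrite grad_feedback dotNl dotZl dot_outer mulrC. Qed.

(** The feedback is convex in the preconditioner, being f composed with an
    affine map; this is the linearization used by online learning. *)
Lemma feedback_gradient_le P Q :
  convex_function (setT : set (convex_lmodType 'cV[R]_n)) f ->
  feedback f y P - feedback f y Q <= dot (grad (feedback f y) P) (P - Q).
Proof.
move=> cf; set g := grad f y.
have := convex_gradient_le (y - P *m g) (y - Q *m g) df cf.
rewrite (_ : y - Q *m g - (y - P *m g) = (P - Q) *m g); last first.
  by rewrite mulmxBl opprB addrC addrA subrK.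
move=> h; rewrite dot_grad_feedback /feedback -/g -mulrBl -mulNr.
by apply: ler_wpM2r; [rewrite invr_ge0 sqr_ge0 | lra].
Qed.

Lemma fnorm_grad_feedback_le (L : R) P :
  (forall u v, fnorm (grad f u - grad f v) <= L * fnorm (u - v)) -> 0 <= L ->
  grad f y != 0 ->
  fnorm (grad (feedback f y) P) <= 1 + L * fnorm P.
Proof.
move=> lipf L0 /fnorm_gt0; set g := grad f y => g0.
rewrite grad_feedback fnormN fnormZ -/g ger0_norm ?invr_ge0 ?sqr_ge0 //.
rewrite mulrC ler_pdivrMr ?exprn_gt0 //.
apply: (le_trans (fnormM _ _)); rewrite fnorm_tr -/g expr2 mulrA ler_pM2r //.
rewrite -[grad f (_ - _)](subrK g).
apply: (le_trans (fnormD _ _)); rewrite mulrDl mul1r addrC lerD2l.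
apply: (le_trans (lipf _ _)); rewrite -mulrA ler_wpM2l //.
by rewrite [y - _]addrC addrK fnormN fnormM.
Qed.

(** By convexity, a step [P *m grad f y] cannot decrease f by more than its
    inner product with the gradient.  This caps how good a feedback may be,
    which turns a good average into few bad iterations. *)
Lemma feedback_ge P :
  convex_function (setT : set (convex_lmodType 'cV[R]_n)) f ->
  grad f y != 0 -> - fnorm P <= feedback f y P.
Proof.
move=> cf /fnorm_gt0; set g := grad f y => g0.
rewrite /feedback -/g ler_pdivlMr ?exprn_gt0 // mulNr lerNl opprB.
have := convex_gradient_le y (y - P *m g) df cf.
rewrite [y - _ - y](_ : _ = - (P *m g)); last by rewrite addrAC subrr add0r.
rewrite dotNr -/g.
have := cauchy_schwarz g (P *m g).
have := ler_wpM2l (fnorm_ge0 g) (fnormM P g).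
rewrite mulrCA -expr2; lra.
Qed.

End Feedback.

(** This gives the existence of a best fixed preconditioner. *)
Lemma feedback_continuous (R : realType) (n : nat) (f : 'cV[R]_n -> R)
    (y : 'cV[R]_n) :
  (forall u, differentiable (f : _ -> R^o) u) -> continuous (feedback f y).
Proof.
move=> df; set g := grad f y.
have entry_cont i j : continuous (fun Q : 'M[R]_n => (y - Q *m g) i j).
  have -> : (fun Q : 'M[R]_n => (y - Q *m g) i j)
      = (fun Q : 'M[R]_n => y i j - \sum_k Q i k * g k j).
    by apply/funext => Q; rewrite !mxE.
  have sum_cont : continuous (fun Q : 'M[R]_n => \sum_k Q i k * g k j).
    apply: continuous_big; first exact: add_continuous.
    by move=> k _ Q; exact: (cvgM (@coord_continuous _ _ _ i k Q) (cvg_cst (g k j))).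
  by move=> Q; exact: (cvgB (cvg_cst (y i j)) (sum_cont Q)).
have arg_cont : continuous (fun Q : 'M[R]_n => y - Q *m g).
  move=> P B [N nN sNB].
  have : \forall Q \near P, forall i j, N i j ((y - Q *m g) i j).
    pose near_i i := [set Q : 'M[R]_n | forall j, N i j ((y - Q *m g) i j)].
    pose near_ij i j := [set Q : 'M[R]_n | N i j ((y - Q *m g) i j)].
    apply: (@filter_forall _ _ near_i _ (nbhs_filter P)) => i.
    apply: (@filter_forall _ _ (near_ij i) _ (nbhs_filter P)) => j.
    exact: (entry_cont i j P _ (nN i j)).
  by apply: filterS => Q; exact: sNB.
move=> P; have f_arg_cont : f (y - Q *m g) @[Q --> P] --> f (y - P *m g).
  apply: (cvg_comp _ _ (arg_cont P)).
  exact: (differentiable_continuous (df _)).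
exact: (cvgM (cvgB f_arg_cont (cvg_cst (f y))) (cvg_cst (fnorm g ^+ 2)^-1)).
Qed.

(** * Projected gradient descent *)

Section ProjectedSubgradient.
Context {R : realType} {m n : nat}.
Variable PP : set 'M[R]_(m, n).
Hypothesis PP_convex : convex_set (PP : set (convex_lmodType 'M[R]_(m, n))).
Implicit Types (X Y Q : 'M[R]_(m, n)).

(** If the angle at Y were acute, moving from Y towards Q inside the convex set
    would come closer to X. *)
Lemma proj_obtuse X Y Q : Defs.proj PP X Y -> PP Q -> dot (X - Y) (Q - Y) <= 0.
Proof.
move=> [PPY minY] PPQ; rewrite leNgt; apply/negP.
move: minY; rewrite /=; set U := X - Y; set W := Q - Y => minY s0.
set s := dot U W in s0; set q := dot W W.
have q0 : 0 <= q by exact: dot_ge0.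
have sq0 : 0 < s + q by rewrite ltr_pwDl.
(* Any step below 2 s / q would do; this one also stays in [0, 1]. *)
set t := s / (s + q).
have t0 : 0 < t by rewrite divr_gt0.
have t1 : t <= 1 by rewrite ler_pdivrMr // mul1r lerDl.
have tE : t * (s + q) = s by rewrite divfK ?gt_eqF.
have PPt : PP (t *: Q + (1 - t) *: Y).
  apply/set_mem.
  exact: (PP_convex (Itv01 (ltW t0) t1) (mem_set PPQ) (mem_set PPY)).
have := minY _ PPt.
rewrite -(ler_pXn2r (ltn0Sn 1)) ?nnegrE ?fnorm_ge0 //.
have -> : X - (t *: Q + (1 - t) *: Y) = U - t *: W.
  by apply/matrixP => i j; rewrite !mxE; ring.
rewrite fnorm_sqrBZ -/s [fnorm W ^+ 2]fnorm_sqr -/q.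
have : 0 < t * s by rewrite mulr_gt0.
have : t * (t * (s + q)) = t * s by rewrite tE.
have : 0 < t * (t * s) by do 2!apply: mulr_gt0 => //.
lra.
Qed.

Lemma proj_dist_le X Y Q :
  Defs.proj PP X Y -> PP Q -> fnorm (Y - Q) ^+ 2 <= fnorm (X - Q) ^+ 2.
Proof.
move=> projY PPQ; have := proj_obtuse projY PPQ.
have := dot_ge0 (X - Y); rewrite !fnorm_sqr !dotE.
rewrite (dotC Y X) (dotC Q X) (dotC Q Y). lra.
Qed.

(** Each projection can only bring the iterate closer to Q, so the squared
    distances to Q telescope; the G k are arbitrary vectors. *)
Lemma projected_subgradient_regret (eta : R) (P G : nat -> 'M[R]_(m, n)) K Q :
  (forall k, (1 <= k <= K)%N -> Defs.proj PP (P k - eta *: G k) (P k.+1)) ->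
  PP Q ->
  2 * eta * \sum_(1 <= k < K.+1) dot (G k) (P k - Q)
    <= fnorm (P 1%N - Q) ^+ 2 - fnorm (P K.+1 - Q) ^+ 2
       + eta ^+ 2 * \sum_(1 <= k < K.+1) fnorm (G k) ^+ 2.
Proof.
move=> + PPQ; elim: K => [|K IH] step.
  by rewrite !big_nil !mulr0 addr0 subrr.
have /IH {}IH : forall k, (1 <= k <= K)%N ->
    Defs.proj PP (P k - eta *: G k) (P k.+1).
  by move=> k /andP[k1 kK]; apply: step; rewrite k1 leqW.
have := proj_dist_le (step K.+1 (leqnn _)) PPQ.
rewrite !(big_nat_recr K.+1) //= !mulrDr.
rewrite [P K.+1 - _ - Q]addrAC fnorm_sqrBZ dotC.
lra.
Qed.

End ProjectedSubgradient.

(** * Minimizers on closed bounded sets of matrices *)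

Section Compactness.
Context {R : realType} {m n : nat}.

(* Compactness is transported from row vectors through [vec_mx]. *)
Lemma vec_mx_continuous : continuous (@vec_mx R m n).
Proof.
move=> v B /nbhs_ballP[e e0 eB]; apply/nbhs_ballP; exists e => // w [_ vw].
by apply: eB; split=> // i j; rewrite !mxE; exact: vw.
Qed.

Lemma bounded_closed_compact_mx (S : set 'M[R]_(m, n)) :
  bounded_set S -> closed S -> compact S.
Proof.
move=> bS cS.
have -> : S = vec_mx @` (vec_mx @^-1` S).
  rewrite eqEsubset; split=> [X SX|_ [v Sv <-]] //.
  by exists (mxvec X) => //=; rewrite mxvecK.
apply: continuous_compact.
  by apply: continuous_subspaceT; exact: vec_mx_continuous.
apply: bounded_closed_compact; last first.
  by apply: closed_comp cS => v _; exact: vec_mx_continuous.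
case: bS => M [Mr MS]; exists M; split=> // b /MS Sb v /= Sv.
have := Sb _ Sv; apply: le_trans.
rewrite [leLHS]/Num.norm [leRHS]/Num.norm /= !mx_normrE.
apply/bigmax_leP; split=> [|[i k] _ /=]; first exact: bigmax_ge_id.
case/mxvec_indexP: k => i' j'; rewrite ord1.
apply/bigmax_geP; right; exists (i', j') => //=.
by rewrite !mxE.
Qed.

Lemma fnorm_bounded (S : set 'M[R]_(m, n)) D :
  (forall X, S X -> fnorm X <= D) -> bounded_set S.
Proof.
move=> SD; exists D; split; first exact: num_real.
move=> b Db X /= /SD XD; rewrite /Num.norm /= mx_normrE.
have D0 : 0 <= b by rewrite (le_trans (fnorm_ge0 X)) // (le_trans XD) ?ltW.
apply/bigmax_leP; split=> // -[i j] _ /=.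
by rewrite (le_trans (coord_le_fnorm _ _ _)) // (le_trans XD) ?ltW.
Qed.

Lemma exists_argmin (S : set 'M[R]_(m, n)) D (F : 'M[R]_(m, n) -> R) :
  S !=set0 -> closed S -> (forall X, S X -> fnorm X <= D) ->
  continuous F -> exists X, argmin S F X.
Proof.
move=> S0 cS SD cF.
have compS := bounded_closed_compact_mx (fnorm_bounded SD) cS.
have [X /set_mem SX minX] :=
  compact_EVT_min S0 compS (continuous_subspaceT cF).
by exists X; split=> // Y SY; exact/minX/mem_set.
Qed.

End Compactness.

(** * The weights A_k and the accelerated step *)

Section Weights.
Variable R : realType.
Implicit Types k : nat.

Lemma A_ge0 k : 0 <= A R k.
Proof.
by elim: k => //= k Ak; rewrite addr_ge0 ?divr_ge0 ?addr_ge0 ?sqrtr_ge0.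
Qed.

Lemma A_step_sqr k : (A R k.+1 - A R k) ^+ 2 = A R k.+1.
Proof.
have := sqr_sqrtr (addr_ge0 (mulr_ge0 (ler0n R 4) (A_ge0 k)) ler01).
rewrite /=; move: (A R k) (Num.sqrt _) => a s; lra.
Qed.

Lemma A_step_gt0 k : 0 < A R k.+1 - A R k.
Proof. by rewrite /= [_ + (_ / _)]addrC addrK divr_gt0 ?ltr_pwDl ?sqrtr_ge0. Qed.

Lemma A_gt0 k : 0 < A R k.+1.
Proof. by rewrite (le_lt_trans (A_ge0 k)) // -subr_gt0 A_step_gt0. Qed.

Lemma A_ge k : k%:R ^+ 2 / 4 <= A R k.
Proof.
elim: k => [|k Ak]; first by rewrite expr0n mul0r.
rewrite -A_step_sqr -natr1 ler_pdivrMr //.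
have : k%:R <= Num.sqrt (4 * A R k + 1) :> R.
  rewrite -[leLHS]ger0_norm ?ler0n // -sqrtr_sqr ler_wsqrtr //; lra.
rewrite /=; have : 0 <= k%:R :> R by [].
move: (A R k) (Num.sqrt _) (k%:R : R) => a s x x0 xs; nra.
Qed.

Lemma A_le k : A R k <= k%:R ^+ 2.
Proof.
elim: k => [|k Ak]; first by rewrite expr0n.
have k0 : 0 <= k%:R :> R by [].
have : Num.sqrt (4 * A R k + 1) <= 2 * k%:R + 1 :> R.
  rewrite -[leRHS]ger0_norm; last by lra.
  rewrite -sqrtr_sqr ler_wsqrtr //; nra.
rewrite /= -natr1; lra.
Qed.

Lemma A_step_le k : A R k.+1 - A R k <= k.+1%:R.
Proof.
have a0 := ltW (A_step_gt0 k).
by rewrite -(ler_pXn2r (ltn0Sn 1)) ?nnegrE // A_step_sqr A_le.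
Qed.

End Weights.

Section Acceleration.
Context {R : realType} {n : nat}.
Variables (f : 'cV[R]_n -> R) (xs : 'cV[R]_n).
Hypothesis df : forall u, differentiable (f : _ -> R^o) u.
Hypothesis cf : convex_function (setT : set (convex_lmodType 'cV[R]_n)) f.

(** The combination of the gradient inequalities at [x] and [xs] with weights
    [A R k] and [a] only involves [z], by the choice of the extrapolated point
    y.  The term in |grad f y|^2 produced by the step in z is cancelled by the
    decrease of f exactly because [a ^+ 2 = A R k.+1]. *)
Lemma accelerated_step (k : nat) (x z xp : 'cV[R]_n) (v : R) :
  let y := extrapolate k x z in
  let zp := z - ((A R k.+1 - A R k) / v) *: grad f y in
  0 < v -> f xp <= f y - fnorm (grad f y) ^+ 2 / (2 * v) ->
  A R k.+1 * (f xp - f xs) - A R k * (f x - f xs)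
    <= v / 2 * (fnorm (z - xs) ^+ 2 - fnorm (zp - xs) ^+ 2).
Proof.
move=> y zp v0 decr; set a := A R k.+1 - A R k.
have fx := convex_gradient_le y x df cf.
have fxs := convex_gradient_le y xs df cf.
have Ek : A R k.+1 = A R k + a by rewrite addrC subrK.
have a0 : 0 < a := A_step_gt0 R k.
have A0 := A_ge0 R k; have A10 := A_gt0 R k.
have aE : a ^+ 2 = A R k.+1 := A_step_sqr R k.
have yE : A R k *: (x - y) + a *: (xs - y) = a *: (xs - z).
  apply/matrixP => i j; rewrite /y /extrapolate /a !mxE; field.
  by rewrite gt_eqF.
have grad_gap : A R k * dot (grad f y) (x - y) + a * dot (grad f y) (xs - y)
    = - (a * dot (z - xs) (grad f y)).
  rewrite -!dotZr -dotDr yE dotZr -opprB dotNr (dotC (grad f y)).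
  by rewrite dotZr mulrN.
rewrite [zp - xs]addrAC fnorm_sqrBZ -/a.
have vV : v * v^-1 = 1 by rewrite divff ?gt_eqF.
have -> : v / 2 * (fnorm (z - xs) ^+ 2 - (fnorm (z - xs) ^+ 2
    - 2 * (a / v) * dot (z - xs) (grad f y)
    + (a / v) ^+ 2 * fnorm (grad f y) ^+ 2))
  = a * dot (z - xs) (grad f y)
    - a ^+ 2 * (fnorm (grad f y) ^+ 2 / (2 * v)).
  by field; rewrite gt_eqF.
have := ler_wpM2l (ltW A10) decr.
have := ler_wpM2l A0 fx; have := ler_wpM2l (ltW a0) fxs.
rewrite aE Ek; move: (_ / (2 * v)) => q.
move: grad_gap; move: (dot _ _) (dot _ _) (dot _ _) => p1 p2 p3.
lra.
Qed.

(** [A R 0 = 0] makes the bound independent of the starting point [x0]. *)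
Lemma agd_rate (L : R) (x0 z0 : 'cV[R]_n) (k : nat) :
  0 < L -> smooth L f ->
  A R k * (f (agd f L x0 z0 k).1 - f xs)
    + L / 2 * fnorm ((agd f L x0 z0 k).2 - xs) ^+ 2
  <= L / 2 * fnorm (z0 - xs) ^+ 2.
Proof.
move=> L0 sf; elim: k => [|k]; first by rewrite mul0r add0r.
rewrite [agd f L x0 z0 k.+1]/=; case: (agd f L x0 z0 k) => x z /= IH.
have := accelerated_step L0 (gradient_step_decrease (extrapolate k x z) L0 sf).
rewrite /=; lra.
Qed.

End Acceleration.

(** * HDM-AGD *)

Section HdmWeight.
Context {R : realType} {n : nat}.
Variables (f : 'cV[R]_n -> R) (L D theta : R) (y : 'cV[R]_n) (P : 'M[R]_n).
Hypotheses (L_gt0 : 0 < L) (theta_ge : 1 / 2 <= theta) (theta_lt : theta < L * D).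
Let v := hdm_weight f L theta y P.

(** Estimates are divided by the weight, so its inverse is the useful form. *)
Lemma hdm_weightV :
  v^-1 = Num.min (2 * Num.max (- feedback f y P) (1 / (2 * L))) (2 * theta / L).
Proof.
have th0 : 0 < theta by move: theta_ge; lra.
rewrite /v /hdm_weight; set m := Num.max _ (1 / (2 * L)).
have m0 : 0 < m by rewrite lt_max divr_gt0 ?orbT ?mulr_gt0.
set p := 2 * m; have p0 : 0 < p by rewrite mulr_gt0.
have q0 : 0 < L / (2 * theta) by rewrite divr_gt0 ?mulr_gt0.
have -> : 2 * theta / L = (L / (2 * theta))^-1 by rewrite invf_div.
move: (L / (2 * theta)) q0 => q q0; rewrite div1r.
have [pq|pq] := leP p^-1 q.
  by rewrite min_r // -(lef_pV2 _ _) ?posrE ?invr_gt0 // invrK.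
by rewrite invrK min_l // -[p]invrK lef_pV2 ?posrE ?invr_gt0 // ltW.
Qed.

Lemma hdm_weight_gt0 : 0 < v.
Proof.
by rewrite lt_max [0 < L / _]divr_gt0 ?orbT // mulr_gt0 //; move: theta_ge; lra.
Qed.

(** The weight is at least the one that the decrease of f permits; the lower
    bound [L / (2 * theta)] can only make the requirement weaker. *)
Lemma hdm_weight_decrease (xp : 'cV[R]_n) :
  grad f y != 0 -> f xp <= f (y - P *m grad f y) ->
  f xp <= f y - fnorm (grad f y) ^+ 2 / (2 * L) ->
  f xp <= f y - fnorm (grad f y) ^+ 2 / (2 * v).
Proof.
move=> /fnorm_gt0 g0 xp_P xp_L.
have G0 : 0 < fnorm (grad f y) ^+ 2 by rewrite exprn_gt0.
have hE : feedback f y P * fnorm (grad f y) ^+ 2 = f (y - P *m grad f y) - f y.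
  by rewrite /feedback divfK ?gt_eqF.
have : v^-1 / 2 <= Num.max (- feedback f y P) (1 / (2 * L)).
  by rewrite ler_pdivrMr // mulrC hdm_weightV ge_min lexx.
rewrite [2 * v]mulrC invfM mulrA.
move/(ler_wpM2l (ltW G0)); rewrite mulrA.
have [_|_] := leP (- feedback f y P); first by lra.
rewrite mulrN [_ * feedback _ _ _]mulrC hE; lra.
Qed.

(** The deficit is nonzero only if [- feedback f y P < theta / L]; then the
    last ratio is at least 1.  Otherwise the ratio is still nonnegative, since
    the feedback is at least [- D].  The bound is affine in the feedback so
    that its sum over the iterations is governed by the regret. *)
Lemma hdm_weight_deficit : - D <= feedback f y P ->
  0 <= 2 * theta / L - v^-1
    <= (2 * theta - 1) / L * ((L * D + L * feedback f y P) / (L * D - theta)).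
Proof.
move=> hD; rewrite hdm_weightV; move: (feedback f y P) hD => h hD.
set m := Num.max _ _.
have th1 := theta_ge.
have gap0 : 0 < L * D - theta by rewrite subr_gt0.
have coef0 : 0 <= (2 * theta - 1) / L by rewrite divr_ge0 ?(ltW L_gt0) //; lra.
have LDh : 0 <= L * D + L * h.
  by rewrite -mulrDr mulr_ge0 ?(ltW L_gt0) //; lra.
have [big|small] := leP (2 * theta / L) (2 * m).
  by rewrite subrr lexx mulr_ge0 // divr_ge0 // ltW.
rewrite subr_ge0 ltW //=.
have mL : 1 / (2 * L) <= m by rewrite le_max lexx orbT.
have mh : - h <= m by rewrite le_max lexx.
have ratio1 : 1 <= (L * D + L * h) / (L * D - theta).
  rewrite ler_pdivlMr // mul1r lerD2l lerNl -mulrN mulrC -ler_pdivlMr //.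
  apply: (le_trans mh); rewrite -(ler_pM2l (ltr0n R 2)) mulrA; exact: ltW.
apply: (@le_trans _ _ ((2 * theta - 1) / L)); last by rewrite ler_peMr.
rewrite mulrBl lerD2l lerN2.
have -> : 1 / L = 2 * (1 / (2 * L)) by field; rewrite gt_eqF.
by rewrite ler_pM2l.
Qed.

End HdmWeight.

Section HdmAgd.
Context {R : realType} {n : nat}.
Variables (f : 'cV[R]_n -> R) (xs : 'cV[R]_n) (L D theta : R).
Variables (PP : set 'M[R]_n) (K : nat).
Variables (x y z : nat -> 'cV[R]_n) (P : nat -> 'M[R]_n).
Hypotheses (L_gt0 : 0 < L) (theta_ge : 1 / 2 <= theta) (theta_lt : theta < L * D).
Hypothesis convf : convex_function (setT : set (convex_lmodType 'cV[R]_n)) f.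
Hypothesis smoothf : smooth L f.
Hypothesis PP_convex : convex_set (PP : set (convex_lmodType 'M[R]_n)).
Hypothesis PP_diam : forall Q Q', PP Q -> PP Q' -> fnorm (Q - Q') <= D.
Hypothesis PP0 : PP 0.
Hypothesis K_gt0 : (1 <= K)%N.
Hypothesis run :
  hdm_agd f L theta (D / ((L * D + 1) * Num.sqrt K%:R)) PP K x y z P.
Hypothesis grad_neq0 : forall k : nat, (1 <= k <= K)%N -> grad f (y k) != 0.

Let D_gt0 : 0 < D.
Proof.
by rewrite -(pmulr_rgt0 _ L_gt0) (lt_trans _ theta_lt) //; move: theta_ge; lra.
Qed.

Let PP_fnorm Q : PP Q -> fnorm Q <= D.
Proof. by move=> PPQ; have := PP_diam PPQ PP0; rewrite subr0. Qed.

Let P_in k : (1 <= k <= K.+1)%N -> PP (P k).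
Proof.
case: run => P1 step; case: k => [//|[_ //|k]] /andP[_ kK].
by have [_ _ [? _] _] := step k.+1 kK.
Qed.

(** The step size balances the two terms [D ^+ 2 / (2 * eta)] and
    [eta * K * (L * D + 1) ^+ 2 / 2] of the regret. *)
Lemma hdm_regret Q : PP Q ->
  \sum_(1 <= k < K.+1) feedback f (y k) (P k)
    <= \sum_(1 <= k < K.+1) feedback f (y k) Q
       + D * (L * D + 1) * Num.sqrt K%:R.
Proof.
move=> PPQ; have [df lipf] := smoothf; have [_ step] := run.
set eta := D / _ in step.
set G := fun k => grad (feedback f (y k)) (P k).
have stepG k : (1 <= k <= K)%N -> Defs.proj PP (P k - eta *: G k) (P k.+1).
  by case/step.
have LD0 : 0 < L * D + 1 by rewrite addr_gt0 ?mulr_gt0.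
have reg := projected_subgradient_regret PP_convex stepG PPQ.
have G_le k : (1 <= k <= K)%N -> fnorm (G k) ^+ 2 <= (L * D + 1) ^+ 2.
  move=> /[dup] kK /andP[k1 kK'].
  rewrite ler_pXn2r ?nnegrE ?fnorm_ge0 ?(ltW LD0) //.
  apply: (le_trans (fnorm_grad_feedback_le df _ lipf (ltW L_gt0) (grad_neq0 kK))).
  by rewrite addrC lerD2r ler_pM2l // PP_fnorm //; apply: P_in; rewrite k1 leqW.
have sumG : \sum_(1 <= k < K.+1) fnorm (G k) ^+ 2 <= K%:R * (L * D + 1) ^+ 2.
  have -> : K%:R * (L * D + 1) ^+ 2 = \sum_(1 <= k < K.+1) (L * D + 1) ^+ 2.
    by rewrite sumr_const_nat subn1 /= mulr_natl.
  by apply: ler_sum_nat => k kK; apply: G_le.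
have lin : \sum_(1 <= k < K.+1) (feedback f (y k) (P k) - feedback f (y k) Q)
    <= \sum_(1 <= k < K.+1) dot (G k) (P k - Q).
  by apply: ler_sum_nat => k kK; apply: feedback_gradient_le.
have dist1 : fnorm (P 1%N - Q) ^+ 2 <= D ^+ 2.
  by rewrite ler_pXn2r ?nnegrE ?fnorm_ge0 ?(ltW D_gt0) // PP_diam //; apply: P_in.
have s0 : 0 < Num.sqrt K%:R :> R by rewrite sqrtr_gt0 ltr0n.
have sE : Num.sqrt K%:R ^+ 2 = K%:R :> R by rewrite sqr_sqrtr.
have eta0 : 0 < eta by rewrite divr_gt0 // mulr_gt0.
rewrite sumrB in lin; rewrite -lerBlDl; apply: (le_trans lin).
rewrite -(ler_pM2l (mulr_gt0 (ltr0n R 2) eta0)); apply: (le_trans reg).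
have -> : 2 * eta * (D * (L * D + 1) * Num.sqrt K%:R)
    = D ^+ 2 + eta ^+ 2 * (K%:R * (L * D + 1) ^+ 2).
  rewrite /eta; move: (Num.sqrt _) s0 sE => s s0 <-.
  by field; rewrite !gt_eqF.
have := ler_wpM2l (sqr_ge0 eta) sumG.
have := sqr_ge0 (fnorm (P K.+1 - Q)); lra.
Qed.

Lemma hdm_monotone k : (1 <= k <= K.+1)%N -> f (x k) <= f (x 1%N).
Proof.
case: run => _ step; case: k => // k /andP[_]; elim: k => [//|k IH] kK.
apply: le_trans (IH (ltnW kK)); have [_ [_ min] _ _] := step k.+1 kK.
by apply: min; right.
Qed.

Lemma hdm_step k : (1 <= k <= K)%N ->
  A R k.+1 * (f (x k.+1) - f xs) - A R k * (f (x k) - f xs)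
    <= hdm_weight f L theta (y k) (P k) / 2
       * (fnorm (z k - xs) ^+ 2 - fnorm (z k.+1 - xs) ^+ 2).
Proof.
case: run => _ step kK; have [df _] := smoothf.
have [yE [_ min] _ zE] := step k kK.
rewrite zE yE; apply: accelerated_step => //.
  exact: hdm_weight_gt0.
rewrite -yE; apply: hdm_weight_decrease => //.
- exact: grad_neq0.
- by apply: min; left; right.
apply: le_trans (gradient_step_decrease (y k) L_gt0 smoothf).
by apply: min; left; left.
Qed.

(** Each step is divided by its weight, so that the distances telescope.
    Replacing the inverse weight by its maximum [2 * theta / L] costs the
    deficit times an increment of the potential, which is at most [M]. *)
Lemma hdm_potential (M : R) :
  0 <= M ->
  (forall k, (1 <= k <= K)%N ->
     A R k.+1 * (f (x k.+1) - f xs) - A R k * (f (x k) - f xs) <= M) ->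
  2 * theta / L * (A R K.+1 * (f (x K.+1) - f xs) - (f (x 1%N) - f xs))
    <= fnorm (z 1%N - xs) ^+ 2 / 2
       + (2 * theta - 1) / L * M / (L * D - theta)
         * \sum_(1 <= k < K.+1) (L * D + L * feedback f (y k) (P k)).
Proof.
move=> M0 M_ge; have [df _] := smoothf.
set Phi := fun k => A R k * (f (x k) - f xs).
set d2 := fun k => fnorm (z k - xs) ^+ 2.
have A1 : A R 1 = 1 by rewrite /= mulr0 !add0r sqrtr1 divff.
have -> : A R K.+1 * (f (x K.+1) - f xs) - (f (x 1%N) - f xs)
    = \sum_(1 <= k < K.+1) (Phi k.+1 - Phi k).
  by rewrite telescope_sumr // /Phi A1 mul1r.
have d2_sum : \sum_(1 <= k < K.+1) (d2 k - d2 k.+1) <= d2 1%N.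
  have -> : \sum_(1 <= k < K.+1) (d2 k - d2 k.+1)
      = - \sum_(1 <= k < K.+1) (d2 k.+1 - d2 k).
    by rewrite -sumrN; apply: eq_bigr => k _; rewrite opprB.
  by rewrite telescope_sumr // opprB lerBlDr lerDl sqr_ge0.
apply: (@le_trans _ _ ((\sum_(1 <= k < K.+1) (d2 k - d2 k.+1)) / 2
    + (2 * theta - 1) / L * M / (L * D - theta)
         * \sum_(1 <= k < K.+1) (L * D + L * feedback f (y k) (P k)))); last first.
  by rewrite lerD2r ler_pM2r ?invr_gt0.
rewrite mulr_suml !mulr_sumr -big_split; apply: ler_sum_nat => k kK /=.
set v := hdm_weight f L theta (y k) (P k).
have v0 : 0 < v := hdm_weight_gt0 _ _ _ L_gt0 theta_ge.
have hD : - D <= feedback f (y k) (P k).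
  have kK1 : (1 <= k <= K.+1)%N by case/andP: kK => -> /leqW.
  have := feedback_ge df (P k) convf (grad_neq0 kK).
  by apply: le_trans; rewrite lerN2 PP_fnorm //; apply: P_in.
have /andP[c0 c1] := hdm_weight_deficit L_gt0 theta_ge theta_lt hD.
rewrite -/v in c0 c1; have := hdm_step kK; rewrite -/v -/(d2 k) -/(d2 k.+1).
have := M_ge k kK; rewrite -/(Phi k) -/(Phi k.+1).
move: (Phi k.+1 - Phi k) => dPhi dPhiM /(ler_wpM2l (ltW (eqbRL (invr_gt0 v) v0))).
rewrite mulrA mulrA mulVf ?gt_eqF // mul1r => dPhi_d.
have := ler_wpM2r M0 c1; have := ler_wpM2l c0 dPhiM.
lra.
Qed.
End HdmAgd.

Lemma diam_le (R : realType) (m n : nat) (S : set 'M[R]_(m, n)) (D : R) :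
  (diam S <= D%:E)%E -> forall X Y, S X -> S Y -> fnorm (X - Y) <= D.
Proof.
move=> SD X Y SX SY; rewrite -lee_fin; apply: le_trans SD.
by apply: ereal_sup_ubound; exists X => //; exists Y.
Qed.

Theorem theorem4p2 (R : realType) (L D theta r : R)
    (L_gt0 : 0 < L) (theta_ge : 1 / 2 <= theta) (theta_lt : theta < L * D) :
  exists C : R,
  forall (n : nat) (f : 'cV[R]_n -> R) (xstar : 'cV[R]_n) (PP : set 'M[R]_n)
    (K : nat) (x' z' : 'cV[R]_n)
    (x y z : nat -> 'cV[R]_n) (P : nat -> 'M[R]_n),
    convex_function (setT : set (convex_lmodType 'cV[R]_n)) f ->
    smooth L f ->
    argmin setT f xstar ->
    closed PP ->
    convex_set (PP : set (convex_lmodType 'M[R]_n)) ->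
    PP 0 ->
    PP (L^-1)%:M ->
    (diam PP <= D%:E)%E ->
    (1 <= K)%N ->
    fnorm (z' - xstar) = r ->
    x 1%N = (agd f L x' z' K).1 ->
    z 1%N = z' ->
    hdm_agd f L theta (D / ((L * D + 1) * Num.sqrt K%:R)) PP K x y z P ->
    (forall k : nat, (1 <= k <= K)%N -> grad f (y k) != 0) ->
    let avg := fun Q : 'M[R]_n =>
      L / K%:R * \sum_(1 <= k < K.+1) feedback f (y k) Q in
    exists2 Pstar : 'M[R]_n, argmin PP avg Pstar &
      let omega := - avg Pstar in
      let rho := D * (L * D + 1) * Num.sqrt K%:R in
      f (x K.+1) - f xstar <=
        (1 / (2 * theta)
         + (8 - 4 / theta) * ((L * D - omega) / (L * D - theta)))
        * (2 * L * fnorm (z' - xstar) ^+ 2 / K%:R ^+ 2)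
        + C * (rho / K%:R ^+ 3).
Proof.
have theta_gt0 : 0 < theta by lra.
have D_gt0 : 0 < D by rewrite -(pmulr_rgt0 _ L_gt0) (lt_trans _ theta_lt).
have LD1_gt0 : 0 < L * D + 1 by rewrite addr_gt0 ?mulr_gt0.
have gap_gt0 : 0 < L * D - theta by rewrite subr_gt0.
exists (2 * L ^+ 2 * r ^+ 2 * (8 - 4 / theta) / (L * D - theta)
        + 8 * L * r ^+ 2 / (D * (L * D + 1))).
move=> n f xs PP K x' z' x y z P cf sf [_ xs_min] PP_closed PP_convex PP0 _
  /diam_le PP_diam K_gt0 rE x1E z1E run grad_neq0 avg.
have [df _] := sf.
have PP_bounded Q : PP Q -> fnorm Q <= D.
  by move=> PPQ; have := PP_diam Q 0 PPQ PP0; rewrite subr0.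
have avg_cont : continuous avg.
  have sum_cont : continuous
      (fun Q => \sum_(1 <= k < K.+1) feedback f (y k) Q).
    apply: continuous_big; first exact: add_continuous.
    by move=> k _; exact: feedback_continuous.
  by move=> Q; exact: (cvgM (cvg_cst (L / K%:R)) (sum_cont Q)).
have [Pstar Pstar_min] :=
  exists_argmin (ex_intro _ _ PP0) PP_closed PP_bounded avg_cont.
exists Pstar => // omega rho; rewrite rE.
have K0 : 0 < K%:R :> R by rewrite ltr0n.
have K1 : 1 <= K%:R :> R by rewrite ler1n.
have r2_ge0 : 0 <= r ^+ 2 by exact: sqr_ge0.
have gap_ge0 u : 0 <= f u - f xs by rewrite subr_ge0 xs_min.
have gap1 : f (x 1%N) - f xs <= 2 * L * r ^+ 2 / K%:R ^+ 2.
  have := agd_rate xs df cf x' z' K L_gt0 sf.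
  rewrite -x1E rE ler_pdivlMr ?exprn_gt0 //.
  have := ler_wpM2r (gap_ge0 (x 1%N)) (A_ge R K).
  have : 0 <= L / 2 * fnorm ((agd f L x' z' K).2 - xs) ^+ 2.
    by rewrite mulr_ge0 ?sqr_ge0 // divr_ge0 // ltW.
  lra.
(* 2 K bounds the increments of A, 2 L r^2 / K^2 the initial gap. *)
pose M := 4 * L * r ^+ 2 / K%:R.
have M_ge0 : 0 <= M 
  by rewrite divr_ge0 ?(ltW K0) // mulr_ge0 // mulr_ge0 // ltW.
have M_ge k : (1 <= k <= K)%N ->
    A R k.+1 * (f (x k.+1) - f xs) - A R k * (f (x k) - f xs) <= M.
  move=> /andP[k1 kK].
  have xk : f (x k) <= f (x 1%N).
    by apply: (hdm_monotone run); rewrite k1 leqW.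
  have xk1 : f (x k.+1) <= f (x k).
    have [_ /(_ k)] := run; rewrite k1 kK => /(_ isT) [_ [_ min] _ _].
    by apply: min; right.
  have step0 := A_step_gt0 R k.
  have step_le : A R k.+1 - A R k <= 2 * K%:R.
    apply: (le_trans (A_step_le R k)).
    by rewrite -natrM ler_nat mul2n -addnn -addn1 leq_add.
  have ME : M = 2 * K%:R * (2 * L * r ^+ 2 / K%:R ^+ 2).
    by rewrite /M; field; rewrite gt_eqF.
  have := ler_wpM2l (ltW (A_gt0 R k)) xk1.
  have := ler_wpM2l (ltW step0) xk.
  have := ler_wpM2r (gap_ge0 (x 1%N)) step_le.
  have := ler_wpM2l (ltW (mulr_gt0 (ltr0n R 2) K0)) gap1.
  rewrite -ME; lra.
have pot := hdm_potential L_gt0 theta_ge theta_lt cf sf PP_diam PP0 run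
  grad_neq0 M_ge0 M_ge.
have reg := hdm_regret L_gt0 theta_ge theta_lt cf sf PP_convex PP_diam PP0
  K_gt0 run grad_neq0 Pstar_min.1.
have s1 : 1 <= Num.sqrt K%:R :> R by rewrite -[leLHS]sqrtr1 ler_wsqrtr.
have w_sum : L * \sum_(1 <= k < K.+1) feedback f (y k) Pstar = - (K%:R * omega).
  by rewrite /omega /avg mulrN opprK; field; rewrite gt_eqF.
have deficit_sum : \sum_(1 <= k < K.+1) (L * D + L * feedback f (y k) (P k))
    <= K%:R * (L * D - omega) + L * rho.
  rewrite big_split /= sumr_const_nat subn1 -mulr_sumr -mulr_natl.
  have := ler_wpM2l (ltW L_gt0) reg; rewrite mulrDr w_sum -/rho; lra.
set coef := (2 * theta - 1) / L * M / (L * D - theta) in pot.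
have coef_ge0 : 0 <= coef.
  rewrite divr_ge0 ?(ltW gap_gt0) // mulr_ge0 // divr_ge0 ?(ltW L_gt0) //; lra.
have {}pot := le_trans pot (lerD (lexx _) (ler_wpM2l coef_ge0 deficit_sum)).
rewrite z1E rE in pot.
have final : f (x K.+1) - f xs
    <= 4 / K%:R ^+ 2 * (A R K.+1 * (f (x K.+1) - f xs)).
  rewrite [leRHS]mulrAC ler_pdivlMr ?exprn_gt0 //.
  have := ler_wpM2r (gap_ge0 (x K.+1)) (A_ge R K.+1).
  have : 0 <= (2 * K%:R + 1) * (f (x K.+1) - f xs).
    by rewrite mulr_ge0 // addr_ge0 // mulr_ge0 // ltW.
  rewrite -natr1; lra.
(* 4 / K^2 bounds the inverse of A_(K+1); L / (2 theta) undoes the factor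
   in front of the potential. *)
have scale_ge0 : 0 <= 2 * L / (theta * K%:R ^+ 2).
  by rewrite divr_ge0 // mulr_ge0 ?sqr_ge0 // ltW.
have := ler_wpM2l scale_ge0 pot.
have -> u : 2 * L / (theta * K%:R ^+ 2) * (2 * theta / L * u)
    = 4 / K%:R ^+ 2 * u by field; rewrite !gt_eqF.
have -> : 2 * L / (theta * K%:R ^+ 2)
    * (r ^+ 2 / 2 + coef * (K%:R * (L * D - omega) + L * rho))
  = (1 / (2 * theta)
      + (8 - 4 / theta) * ((L * D - omega) / (L * D - theta)))
     * (2 * L * r ^+ 2 / K%:R ^+ 2)
    + 2 * L ^+ 2 * r ^+ 2 * (8 - 4 / theta) / (L * D - theta)
      * (rho / K%:R ^+ 3).
  by rewrite /coef /M; field; rewrite !gt_eqF.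
have tail : 4 / K%:R ^+ 2 * (f (x 1%N) - f xs)
    <= 8 * L * r ^+ 2 / (D * (L * D + 1)) * (rho / K%:R ^+ 3).
  have -> : 8 * L * r ^+ 2 / (D * (L * D + 1)) * (rho / K%:R ^+ 3)
      = 4 / K%:R ^+ 2 * (2 * L * r ^+ 2 / K%:R ^+ 2 * (K%:R * Num.sqrt K%:R)).
    by rewrite /rho; field; rewrite !gt_eqF.
  rewrite ler_pM2l ?divr_gt0 ?exprn_gt0 //; apply: (le_trans gap1).
  by rewrite ler_peMr ?mulr_ege1 // (le_trans (gap_ge0 _) gap1).
rewrite mulrBr mulrDl; lra.
Qed.
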